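(* Let $X,Y,X_i,Y_i$ ($i=1,2$), $\Phi$ and the induced functions $\phi$ (primal) and $\psi$ (dual) be as in the context. Let $\phi'_{x_1},\phi'_{y_1}$ be regular sub- and supergradient fields of $\phi$ associated with $\Phi$, and let $$\mathcal{I}_t=\{[x_{1,i};y_{1,i}]\in X_1\times Y_1,\ [\alpha_i:=\phi'_{x_1}(x_{1,i},y_{1,i});\ \beta_i:=-\phi'_{y_1}(x_{1,i},y_{1,i})]:1\leq i\leq t\}$$ be an execution protocol associated with $\phi,X_1,Y_1$. Then there exist $x_{2,i}\in X_2[x_{1,i}]$, $G_i\in\mathcal{X}$, $y_{2,i}\in Y_2[y_{1,i}]$ and $H_i\in\mathcal{Y}$, $1\le i\le t$, such that, with $x_i:=[x_{1,i};x_{2,i}]$ and $y_i:=[y_{1,i};y_{2,i}]$, (a) $G_i\in\partial_x\Phi(x_i,y_i)$, (b) $H_i\in\partial_y[-\Phi(x_i,y_i)]$, (c) $\langle G_i,x-[x_{1,i};x_{2,i}]\rangle\geq\langle\phi'_{x_1}(x_{1,i},y_{1,i}),x_1-x_{1,i}\rangle$ for all $x=[x_1;x_2]\in X$, (d) $\langle H_i,y-[y_{1,i};y_{2,i}]\rangle\geq\langle-\phi'_{y_1}(x_{1,i},y_{1,i}),y_1-y_{1,i}\rangle$ for all $y=[y_1;y_2]\in Y$, implying that $$\mathcal{J}_t=\{z_i=[x_i;y_i],\ F_i=[G_i;H_i]:1\leq i\leq t\}$$ is an execution protocol associated with $\Phi,X,Y$. For every $t$-step accuracy certificate $\lambda$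 it holds $$\mathrm{Res}(\mathcal{J}_t,\lambda|X\times Y)\leq\mathrm{Res}(\mathcal{I}_t,\lambda|X_1\times Y_1).$$ As a result, given a $t$-step accuracy certificate $\lambda$ and setting $$[x^t;y^t]=[[x_1^t;x_2^t];[y_1^t;y_2^t]]=\sum_{i=1}^t\lambda_i\left[[x_{1,i};x_{2,i}];[y_{1,i};y_{2,i}]\right],$$ one has $$\epsilon_{\rm sad}([x^t;y^t]\,|\,\Phi,X,Y)\leq\mathrm{Res}(\mathcal{I}_t,\lambda|X_1\times Y_1),$$ whence also $$\epsilon_{\rm sad}([x_1^t;y_1^t]\,|\,\phi,X_1,Y_1)\leq\mathrm{Res}(\mathcal{I}_t,\lambda|X_1\times Y_1),\qquad \epsilon_{\rm sad}([x_2^t;y_2^t]\,|\,\psi,X_2,Y_2)\leq\mathrm{Res}(\mathcal{I}_t,\lambda|X_1\times Y_1).$$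
   Context: Notation: $[a;b]$ denotes vertical concatenation, i.e. the pair $(a,b)$ in the product of Euclidean spaces. Setting. $\mathcal{X}_1,\mathcal{X}_2,\mathcal{Y}_1,\mathcal{Y}_2$ are Euclidean spaces; $X_i\subset\mathcal{X}_i$ and $Y_i\subset\mathcal{Y}_i$ ($i=1,2$) are nonempty convex compact sets; $X\subset X_1\times X_2\subset\mathcal{X}:=\mathcal{X}_1\times\mathcal{X}_2$ and $Y\subset Y_1\times Y_2\subset\mathcal{Y}:=\mathcal{Y}_1\times\mathcal{Y}_2$ are convex compact sets such that the projection of $X$ onto $\mathcal{X}_i$ is $X_i$ and the projection of $Y$ onto $\mathcal{Y}_i$ is $Y_i$, $i=1,2$. For $x_1\in X_1$, $X_2[x_1]=\{x_2:[x_1;x_2]\in X\}$; for $x_2\in X_2$, $X_1[x_2]=\{x_1:[x_1;x_2]\in X\}$; for $y_1\in Y_1$, $Y_2[y_1]=\{y_2:[y_1;y_2]\in Y\}$; for $y_2\in Y_2$, $Y_1[y_2]=\{y_1:[y_1;y_2]\in Y\}$. $\Phi(x=[x_1;x_2];y=[y_1;y_2]):X\times Y\to\mathbf{R}$ is Lipschitz continuous, convex in $x\in X$ and concave in $y\in Y$; it is also written $\Phi(x_1,x_2;y_1,y_2)$. Induced functions on $X_1\times Y_1$, resp. $X_2\times Y_2$: $$\phi(x_1,y_1)=\min_{x_2\in X_2[x_1]}\max_{y_2\in Y_2[y_1]}\Phi(x_1,x_2;y_1,y_2),\qquad \psi(x_2,y_2)=\min_{x_1\in X_1[x_2]}\max_{y_1\in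 Y_1[y_2]}\Phi(x_1,x_2;y_1,y_2)$$ (min and max can be swapped in both formulas). Both are convex and lower semicontinuous in the first argument and concave and upper semicontinuous in the second. The saddle point frontier $\mathcal{S}$ of $\Phi$ is the set of pairs $(\bar{x}=[\bar{x}_1;\bar{x}_2],\bar{y}=[\bar{y}_1;\bar{y}_2])\in X\times Y$ such that $(\bar x_2,\bar y_2)$ is a saddle point of $\Phi(\bar{x}_1,x_2;\bar{y}_1,y_2)$ (min in $x_2\in X_2[\bar{x}_1]$, max in $y_2\in Y_2[\bar{y}_1]$). Let $\bar z=(\bar x,\bar y)\in\mathcal{S}$. A subgradient $G\in\mathcal{X}$ of $\Phi(\cdot;\bar y)$ at $\bar x$ along $X$ is a regular subgradient of $\Phi$ at $\bar z$ if for some $g\in\mathcal{X}_1$ one has $\langle G,x-\bar{x}\rangle\geq\langle g,x_1-\bar{x}_1\rangle$ for all $x=[x_1;x_2]\in X$; every such $g$ is called compatible with $G$. A supergradient $H\in\mathcal{Y}$ of the concave function $\Phi(\bar x;\cdot)$ at $\bar y$ along $Y$ is a regular supergradient of $\Phi$ at $\bar z$ if for some $h\in\mathcal{Y}_1$ one has $\langle H,y-\bar{y}\rangle\leq\langle h,y_1-\bar{y}_1\rangle$ for all $y=[y_1;y_2]\in Y$; every such $h$ is called compatible with $H$. (Such $g$ and $h$ are then a subgradient in $x_1$, resp. a supergradient in $y_1$, of $\phi$ at $(\bar x_1,\bar y_1)$.) Functions $\phi'_{x_1}:X_1\times Y_1\to\mathcal{X}_1$, $\phi'_{y_1}:X_1\times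 Y_1\to\mathcal{Y}_1$ are called regular sub- and supergradient fields of $\phi$ (associated with $\Phi$) if for every $(x_1,y_1)\in X_1\times Y_1$ there are $\bar{x}_2,\bar{y}_2$ such that $\bar{z}=([x_1;\bar{x}_2],[y_1;\bar{y}_2])\in\mathcal{S}$, $\phi'_{x_1}(x_1,y_1)$ is compatible with some regular subgradient of $\Phi$ at $\bar{z}$, and $\phi'_{y_1}(x_1,y_1)$ is compatible with some regular supergradient of $\Phi$ at $\bar{z}$. For a convex-concave $\theta:U\times V\to\mathbf{R}$ with convex compact $U,V$, a $t$-step execution protocol associated with $\theta,U,V$ is a collection $\{w_i=[u_i;v_i]\in U\times V,\ M_i=[M_{u,i};M_{v,i}]:1\le i\le t\}$ with $M_{u,i}\in\partial_u\theta(u_i,v_i)$ and $M_{v,i}\in\partial_v[-\theta(u_i,v_i)]$ (subgradients taken along $U$, resp. $V$). A $t$-step accuracy certificate is a vector $\lambda\in\mathbf{R}^t$ with nonnegative entries summing to 1. For a protocol $\mathcal{I}_t=\{w_i\in W,M_i:1\le i\le t\}$ on a convex compact set $W$, the residual is $\mathrm{Res}(\mathcal{I}_t,\lambda|W)=\max_{w\in W}\sum_{i=1}^t\lambda_i\langle M_i,w_i-w\rangle$. Here $\partial_x\Phi$ and $\partial_y[-\Phi]$ are subdifferentials taken along $X$, resp. $Y$. Saddle point residual: $\epsilon_{\rm sad}([u;v]\,|\,\theta,U,V)=\sup_{v'\in V}\theta(u,v')-\inf_{u'\in U}\theta(u',v)$. *)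

(* Defs.v *)
From mathcomp Require Export all_boot all_order all_algebra.
From mathcomp Require Export all_classical all_reals all_analysis.

Set Implicit Arguments.
Unset Strict Implicit.
Unset Printing Implicit Defensive.

Export Order.TTheory GRing.Theory Num.Theory.
Export numFieldNormedType.Exports.

Local Open Scope classical_set_scope.
Local Open Scope ring_scope.

(* Euclidean spaces are the spaces 'rV[R]_n with the standard inner product.
   The concatenation [a; b] is row_mx a b, so that a product of Euclidean spaces
   is again one; lsubmx and rsubmx are the two components. *)

Section Euclidean.
Context {R : realType}.

Definition dot n (u v : 'rV[R]_n) : R := \sum_(i < n) u 0 i * v 0 i.

Definition prodset p q (U : set 'rV[R]_p) (V : set 'rV[R]_q)
    : set 'rV[R]_(p + q) :=
  [set w | U (lsubmx w) /\ V (rsubmx w)].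

(* Z_2[a] = {b : [a; b] \in Z} and Z_1[b] = {a : [a; b] \in Z} *)
Definition section2 p q (Z : set 'rV[R]_(p + q)) (a : 'rV[R]_p)
    : set 'rV[R]_q := [set b | Z (row_mx a b)].

Definition section1 p q (Z : set 'rV[R]_(p + q)) (b : 'rV[R]_q)
    : set 'rV[R]_p := [set a | Z (row_mx a b)].

(* Sub- and superdifferential at x of f taken along the set D: f is only looked
   at on D. *)
Definition subdiff n (D : set 'rV[R]_n) (f : 'rV[R]_n -> R) (x : 'rV[R]_n)
    : set 'rV[R]_n :=
  [set g | forall x', D x' -> f x + dot g (x' - x) <= f x'].

Definition superdiff n (D : set 'rV[R]_n) (f : 'rV[R]_n -> R) (x : 'rV[R]_n)
    : set 'rV[R]_n :=
  [set h | forall x', D x' -> f x' <= f x + dot h (x' - x)].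

Definition saddle_point p q (U : set 'rV[R]_p) (V : set 'rV[R]_q)
    (theta : 'rV[R]_p -> 'rV[R]_q -> R) (u : 'rV[R]_p) (v : 'rV[R]_q) : Prop :=
  [/\ U u, V v,
      forall u', U u' -> theta u v <= theta u' v
    & forall v', V v' -> theta u v' <= theta u v].

(* The suprema and infima below are extended reals, so no default value
   is involved. *)
Definition eps_sad p q (theta : 'rV[R]_p -> 'rV[R]_q -> R)
    (U : set 'rV[R]_p) (V : set 'rV[R]_q) (w : 'rV[R]_(p + q)) : \bar R :=
  (ereal_sup [set (theta (lsubmx w) v')%:E | v' in V]
   - ereal_inf [set (theta u' (rsubmx w))%:E | u' in U])%E.

Definition certificate t (lambda : 'rV[R]_t) : Prop :=
  (forall i, 0 <= lambda 0 i) /\ \sum_(i < t) lambda 0 i = 1.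

Definition protocol p q (theta : 'rV[R]_p -> 'rV[R]_q -> R)
    (U : set 'rV[R]_p) (V : set 'rV[R]_q) t (w M : 'I_t -> 'rV[R]_(p + q))
    : Prop :=
  forall i : 'I_t,
    [/\ prodset U V (w i),
        subdiff U (fun u => theta u (rsubmx (w i))) (lsubmx (w i))
          (lsubmx (M i))
      & subdiff V (fun v => - theta (lsubmx (w i)) v) (rsubmx (w i))
          (rsubmx (M i))].

Definition Res n t (w M : 'I_t -> 'rV[R]_n) (lambda : 'rV[R]_t)
    (W : set 'rV[R]_n) : \bar R :=
  ereal_sup [set (\sum_(i < t) lambda 0 i * dot (M i) (w i - w'))%:E
            | w' in W].

End Euclidean.

Section Induced.
Context {R : realType} {n1 n2 m1 m2 : nat}.
Variables (X : set 'rV[R]_(n1 + n2)) (Y : set 'rV[R]_(m1 + m2)).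
Variable Phi : 'rV[R]_(n1 + n2) -> 'rV[R]_(m1 + m2) -> R.

(* The primal and dual induced functions. For X, Y compact and Phi Lipschitz on
   X x Y, the real inf and sup are attained whenever the sections of X and Y are
   nonempty; other arguments give meaningless values. *)
Definition primal (x1 : 'rV[R]_n1) (y1 : 'rV[R]_m1) : R :=
  inf [set sup [set Phi (row_mx x1 x2) (row_mx y1 y2) | y2 in section2 Y y1]
      | x2 in section2 X x1].

Definition dual (x2 : 'rV[R]_n2) (y2 : 'rV[R]_m2) : R :=
  inf [set sup [set Phi (row_mx x1 x2) (row_mx y1 y2) | y1 in section1 Y y2]
      | x1 in section1 X x2].

Definition frontier : set ('rV[R]_(n1 + n2) * 'rV[R]_(m1 + m2)) :=
  [set z | [/\ X z.1, Y z.2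
    & saddle_point (section2 X (lsubmx z.1)) (section2 Y (lsubmx z.2))
        (fun x2 y2 => Phi (row_mx (lsubmx z.1) x2) (row_mx (lsubmx z.2) y2))
        (rsubmx z.1) (rsubmx z.2)]].

Definition sub_compatible (xbar G : 'rV[R]_(n1 + n2)) (g : 'rV[R]_n1) : Prop :=
  forall x, X x -> dot G (x - xbar) >= dot g (lsubmx x - lsubmx xbar).

Definition super_compatible (ybar H : 'rV[R]_(m1 + m2)) (h : 'rV[R]_m1)
    : Prop :=
  forall y, Y y -> dot H (y - ybar) <= dot h (lsubmx y - lsubmx ybar).

Definition regular_subgradient
    (z : 'rV[R]_(n1 + n2) * 'rV[R]_(m1 + m2)) (G : 'rV[R]_(n1 + n2)) : Prop :=
  subdiff X (fun x => Phi x z.2) z.1 G /\ exists g, sub_compatible z.1 G g.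

Definition regular_supergradient
    (z : 'rV[R]_(n1 + n2) * 'rV[R]_(m1 + m2)) (H : 'rV[R]_(m1 + m2)) : Prop :=
  superdiff Y (fun y => Phi z.1 y) z.2 H /\ exists h, super_compatible z.2 H h.

Definition regular_fields (X1 : set 'rV[R]_n1) (Y1 : set 'rV[R]_m1)
    (phix : 'rV[R]_n1 -> 'rV[R]_m1 -> 'rV[R]_n1)
    (phiy : 'rV[R]_n1 -> 'rV[R]_m1 -> 'rV[R]_m1) : Prop :=
  forall x1 y1, X1 x1 -> Y1 y1 ->
    exists (x2 : 'rV[R]_n2) (y2 : 'rV[R]_m2),
      let z := (row_mx x1 x2, row_mx y1 y2) in
      [/\ frontier z,
          exists G, regular_subgradient z G /\
                    sub_compatible z.1 G (phix x1 y1)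
        & exists H, regular_supergradient z H /\
                    super_compatible z.2 H (phiy x1 y1)].

End Induced.

(* Main.v *)
Require Import Defs.
From mathcomp Require Import lra.

(** Any regular sub- and supergradients of [Phi] compatible with the given
    fields serve as [G_i] and [- H_i]. Compatibility bounds the residual of the
    lifted protocol at [w] termwise by that of the induced one at the projection
    of [w]. By the subgradient inequalities and Jensen, the lifted residual
    bounds every gap [Phi(x^t, y') - Phi(x', y^t)]. Bounding the min in [phi] at
    [x_1^t] from above by the value at [x_2^t], and the max in [phi] at [y_1^t]
    from below by the value at [y_2^t], passes the gap bound to [phi], and
    symmetrically to [psi]: no min-max interchange is involved. *)

Set Implicit Arguments.
Unset Strict Implicit.
Unset Printing Implicit Defensive.

Local Open Scope classical_set_scope.
Local Open Scope ring_scope.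

(** * Inner products of concatenated vectors *)

Section Dot.
Context {R : realType}.

Lemma dotNl n (u v : 'rV[R]_n) : dot (- u) v = - dot u v.
Proof. by rewrite /dot -sumrN; apply: eq_bigr => i _; rewrite mxE mulNr. Qed.

Lemma dotNr n (u v : 'rV[R]_n) : dot u (- v) = - dot u v.
Proof. by rewrite /dot -sumrN; apply: eq_bigr => i _; rewrite mxE mulrN. Qed.

Lemma dot_row_mx p q (a : 'rV[R]_p) (b : 'rV[R]_q) (w : 'rV[R]_(p + q)) :
  dot (row_mx a b) w = dot a (lsubmx w) + dot b (rsubmx w).
Proof.
rewrite /dot big_split_ord /=; congr (_ + _); apply: eq_bigr => i _.
  by rewrite row_mxEl mxE.
by rewrite row_mxEr mxE.
Qed.

(** Residual terms pair [M_i] with [w_i - w], while subgradient inequalities and compatibility pair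
    it with [w - w_i]; the outer minus sign converts one into the other, block by block. *)
Lemma dot_row_mxB p q (a u : 'rV[R]_p) (b v : 'rV[R]_q) (w : 'rV[R]_(p + q)) :
  dot (row_mx a b) (row_mx u v - w)
  = - (dot a (lsubmx w - u) + dot b (rsubmx w - v)).
Proof.
by rewrite dot_row_mx !linearB /= row_mxKl row_mxKr opprD -!dotNr !opprB.
Qed.

End Dot.

(** * Jensen's inequality for finite weighted families *)

Section Jensen.
Context {R : realType} {E : lmodType R}.
Variable D : set (convex_lmodType E).

(** Convexity is given for weights [t] and [1 - t]; taking [t = a / (a + b)] yields the form with
    unnormalised weights on which an induction over lists can run. *)
Lemma convex_combination (f : E -> R) :
  convex_set D -> convex_function D f ->
  forall (x y : E) (a b : R), 0 <= a -> 0 <= b -> 0 < a + b ->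
  D x -> D y ->
  D ((a + b)^-1 *: (a *: x + b *: y)) /\
  f ((a + b)^-1 *: (a *: x + b *: y)) <= (a + b)^-1 * (a * f x + b * f y).
Proof.
move=> cD cf x y a b a0 b0 ab0 Dx Dy.
have t0 : 0 <= a / (a + b) by rewrite divr_ge0// ltW.
have t1 : a / (a + b) <= 1 by rewrite ler_pdivrMr// mul1r lerDl.
have tE : 1 - a / (a + b) = b / (a + b).
  by rewrite -[X in X - _](@divff _ (a + b)) ?gt_eqF// -mulrBl addrAC subrr add0r.
pose t : {i01 R} := Itv01 t0 t1.
have tconv : conv t (x : convex_lmodType E) y
             = (a + b)^-1 *: (a *: x + b *: y) :> E.
  by rewrite scalerDr !scalerA ![_^-1 * _]mulrC -tE.
have := cf t x y (mem_set Dx) (mem_set Dy).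
have := cD x y t (mem_set Dx) (mem_set Dy).
rewrite tconv => /set_mem DC; rewrite convRE /= /unstable.onem tE => fC; split=> //.
by rewrite mulrDr !mulrA ![_^-1 * _]mulrC.
Qed.

(** The weights of a tail do not sum to one, hence the division by the total. Membership and
    inequality are proved together, since the inductive step applies convexity at the barycentre of
    the tail. *)
Lemma jensen_seq (f : E -> R) (I : eqType) (s : seq I) (a : I -> R)
    (x : I -> E) :
  convex_set D -> convex_function D f ->
  (forall i, 0 <= a i) -> (forall i, D (x i)) -> 0 < \sum_(i <- s) a i ->
  D ((\sum_(i <- s) a i)^-1 *: \sum_(i <- s) a i *: x i) /\
  f ((\sum_(i <- s) a i)^-1 *: \sum_(i <- s) a i *: x i)
    <= (\sum_(i <- s) a i)^-1 * \sum_(i <- s) a i * f (x i).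
Proof.
move=> cD cf a0 Dx; elim: s => [|i s IH]; first by rewrite big_nil ltxx.
rewrite !big_cons => as0.
have : 0 <= \sum_(j <- s) a j by exact: sumr_ge0.
rewrite le_eqVlt => /predU1P[s0|s0].
  have aj j : j \in s -> a j = 0.
    move=> js; move/esym/eqP: s0; rewrite psumr_eq0// => /allP /(_ j js).
    by move/eqP.
  have ai0 : a i != 0 by rewrite -s0 addr0 in as0; rewrite gt_eqF.
  have -> : \sum_(j <- s) a j *: x j = 0.
    by rewrite big_seq big1// => j /aj ->; rewrite scale0r.
  have -> : \sum_(j <- s) a j * f (x j) = 0.
    by rewrite big_seq big1// => j /aj ->; rewrite mul0r.
  rewrite -s0.
  by rewrite !addr0 scalerA mulrA mulVf// scale1r mul1r.
have [Dy fy] := IH s0.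
set S := \sum_(j <- s) a j in s0 as0 Dy fy *.
have [] := convex_combination cD cf (a0 i) (ltW s0) as0 (Dx i) Dy.
rewrite scalerA divff ?gt_eqF// scale1r => DC fC; split=> //.
apply: (le_trans fC); rewrite ler_wpM2l ?invr_ge0 ?(ltW as0)// lerD2l.
by rewrite -ler_pdivlMl.
Qed.

Lemma jensen (f : E -> R) t (lambda : 'rV[R]_t) (x : 'I_t -> E) :
  convex_set D -> convex_function D f -> certificate lambda ->
  (forall i, D (x i)) ->
  D (\sum_i lambda 0 i *: x i) /\
  f (\sum_i lambda 0 i *: x i) <= \sum_i lambda 0 i * f (x i).
Proof.
move=> cD cf [l0 l1] Dx.
have := jensen_seq (s := index_enum 'I_t) cD cf l0 Dx.
by rewrite l1 invr1 mul1r scale1r; apply; exact: ltr01.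
Qed.

End Jensen.

(** * Inf-sup values of bounded functions *)

Section InfSup.
Context {R : realType} {S T : Type}.
Variables (U : set S) (V : set T) (f : S -> T -> R) (C : R).
Hypothesis fC : forall x y, U x -> V y -> `|f x y| <= C.

Local Notation infsup := (inf [set sup [set f x y | y in V] | x in U]).

Lemma le_sup_section x y : U x -> V y -> f x y <= sup [set f x y | y in V].
Proof.
move=> Ux Vy; apply: ub_le_sup; last by exists y.
by exists C => _ [y' Vy' <-]; have := fC Ux Vy'; rewrite ler_norml => /andP[].
Qed.

(** The outer infimum is tested at the single point [x]. The bound [C] and a point of [V] keep the
    real [inf] and [sup] away from their default values. *)
Lemma infsup_le x b : V !=set0 -> U x -> (forall y, V y -> f x y <= b) ->
  infsup <= b.
Proof.
move=> [y0 Vy0] Ux fb; apply: (@le_trans _ _ (sup [set f x y | y in V])).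
  apply: ge_inf; last by exists x.
  exists (- C) => _ [x' Ux' <-]; apply: le_trans (le_sup_section Ux' Vy0).
  by have := fC Ux' Vy0; rewrite ler_norml => /andP[].
apply: ge_sup; first by exists (f x y0), y0.
by move=> _ [y Vy <-]; exact: fb.
Qed.

(** Every inner supremum is tested at the same point [y]; a point of [U] rules out the default value
    of [inf] on the empty set. *)
Lemma infsup_ge y b : U !=set0 -> V y -> (forall x, U x -> b <= f x y) ->
  b <= infsup.
Proof.
move=> [x0 Ux0] Vy fb; apply: lb_le_inf.
  by exists (sup [set f x0 y | y in V]), x0.
by move=> _ [x Ux <-]; apply: le_trans (le_sup_section Ux Vy); exact: fb.
Qed.

End InfSup.

(** Every value is compared with the one at a fixed [z0] of [A], and two points of norm at most [M]
    are at distance at most [M + M]. *)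
Lemma lipschitz_compact_bounded {R : realType} {V W : normedModType R}
    (A : set V) (f : V -> W) :
  compact A -> [lipschitz f z | z in A] ->
  exists C, forall z, A z -> `|f z| <= C.
Proof.
move=> /compact_bounded /pinfty_ex_gt0 [M _ MA] /pinfty_ex_gt0 [k k0 kf].
have [[z0 Az0]|A0] := pselect (A !=set0); last first.
  by exists 0 => z Az; exfalso; apply: A0; exists z.
exists (`|f z0| + k * (M + M)) => z Az.
rewrite -[f z](subrK (f z0)) addrC (le_trans (ler_normD _ _))// lerD2l.
apply: (le_trans (kf (z, z0) (conj Az Az0))).
rewrite ler_wpM2l ?(ltW k0)// (le_trans (ler_normB _ _))// lerD//; exact: MA.
Qed.

(** For fixed [u] the hypothesis bounds the supremum; letting [u] vary then bounds the infimum from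
    below. Points of [U] and [V] make both finite, so the extended difference is a real one. *)
Lemma eps_sad_le_fin {R : realType} p q (theta : 'rV[R]_p -> 'rV[R]_q -> R)
    (U : set 'rV[R]_p) (V : set 'rV[R]_q) (w : 'rV[R]_(p + q)) (r : R) :
  U !=set0 -> V !=set0 ->
  (forall u v, U u -> V v -> theta (lsubmx w) v <= r + theta u (rsubmx w)) ->
  (eps_sad theta U V w <= r%:E)%E.
Proof.
move=> [u0 Uu0] [v0 Vv0] H; rewrite /eps_sad.
set s := ereal_sup _; set i := ereal_inf _.
have si : (forall u, U u -> s <= (r + theta u (rsubmx w))%:E)%E.
  by move=> u Uu; apply: ge_ereal_sup => _ [v Vv <-]; rewrite lee_fin H.
have s0 : ((theta (lsubmx w) v0)%:E <= s)%E by apply: ereal_sup_ubound; exists v0.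
have i0 : (i <= (theta u0 (rsubmx w))%:E)%E by apply: ereal_inf_lbound; exists u0.
move: s si s0 => [s||] si s0 //; last by have := si _ Uu0; rewrite leNgt ltry.
have : ((s - r)%:E <= i)%E.
  apply: le_ereal_inf_tmp => _ [u Uu <-]; have := si u Uu.
  by rewrite !lee_fin lerBlDl.
move: i i0 => [i||] // _; rewrite lee_fin => sri.
by rewrite -EFinB lee_fin lerBlDl -lerBlDr.
Qed.

Theorem proposition2 (R : realType) (n1 n2 m1 m2 : nat)
    (X1 : set 'rV[R]_n1) (X2 : set 'rV[R]_n2)
    (Y1 : set 'rV[R]_m1) (Y2 : set 'rV[R]_m2)
    (X : set 'rV[R]_(n1 + n2)) (Y : set 'rV[R]_(m1 + m2))
    (Phi : 'rV[R]_(n1 + n2) -> 'rV[R]_(m1 + m2) -> R)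
    (hX1 : [/\ X1 !=set0, convex_set X1 & compact X1])
    (hX2 : [/\ X2 !=set0, convex_set X2 & compact X2])
    (hY1 : [/\ Y1 !=set0, convex_set Y1 & compact Y1])
    (hY2 : [/\ Y2 !=set0, convex_set Y2 & compact Y2])
    (hX : [/\ X `<=` prodset X1 X2, convex_set X & compact X])
    (hY : [/\ Y `<=` prodset Y1 Y2, convex_set Y & compact Y])
    (hprojX : [set lsubmx x | x in X] = X1 /\ [set rsubmx x | x in X] = X2)
    (hprojY : [set lsubmx y | y in Y] = Y1 /\ [set rsubmx y | y in Y] = Y2)
    (hlip : [lipschitz (Phi z.1 z.2 : R^o) | z in X `*` Y])
    (hconvex : forall y, Y y -> convex_function X (fun x => Phi x y))
    (hconcave : forall x, X x -> convex_function Y (fun y => - Phi x y))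
    (phix : 'rV[R]_n1 -> 'rV[R]_m1 -> 'rV[R]_n1)
    (phiy : 'rV[R]_n1 -> 'rV[R]_m1 -> 'rV[R]_m1)
    (hreg : regular_fields X Y Phi X1 Y1 phix phiy)
    (t : nat) (x1 : 'I_t -> 'rV[R]_n1) (y1 : 'I_t -> 'rV[R]_m1) :
  let phi := primal X Y Phi in
  let psi := dual X Y Phi in
  let wI := fun i => row_mx (x1 i) (y1 i) in
  let MI := fun i => row_mx (phix (x1 i) (y1 i)) (- phiy (x1 i) (y1 i)) in
  protocol phi X1 Y1 wI MI ->
  exists (x2 : 'I_t -> 'rV[R]_n2) (G : 'I_t -> 'rV[R]_(n1 + n2))
         (y2 : 'I_t -> 'rV[R]_m2) (H : 'I_t -> 'rV[R]_(m1 + m2)),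
    let x := fun i => row_mx (x1 i) (x2 i) in
    let y := fun i => row_mx (y1 i) (y2 i) in
    let z := fun i => row_mx (x i) (y i) in
    let F := fun i => row_mx (G i) (H i) in
    [/\ forall i, section2 X (x1 i) (x2 i) /\ section2 Y (y1 i) (y2 i),
        (forall i,
          [/\ subdiff X (fun x' => Phi x' (y i)) (x i) (G i),
              subdiff Y (fun y' => - Phi (x i) y') (y i) (H i),
              forall x', X x' ->
                dot (G i) (x' - x i)
                  >= dot (phix (x1 i) (y1 i)) (lsubmx x' - x1 i)
            & forall y', Y y' ->
                dot (H i) (y' - y i)
                  >= dot (- phiy (x1 i) (y1 i)) (lsubmx y' - y1 i)]),
        protocol Phi X Y z F
      & forall lambda : 'rV[R]_t, certificate lambda ->
        let r := Res wI MI lambda (prodset X1 Y1) in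
        let zt := \sum_(i < t) lambda 0 i *: z i in
        let xt := lsubmx zt in
        let yt := rsubmx zt in
        [/\ (Res z F lambda (prodset X Y) <= r)%E,
            (eps_sad Phi X Y (row_mx xt yt) <= r)%E,
            (eps_sad phi X1 Y1 (row_mx (lsubmx xt) (lsubmx yt)) <= r)%E
          & (eps_sad psi X2 Y2 (row_mx (rsubmx xt) (rsubmx yt)) <= r)%E]].
Proof.
move=> phi psi wI MI protI.
have [_ cvX cX] := hX; have [_ cvY cY] := hY.
have [C PhiC] : exists C, forall x y, X x -> Y y -> `|Phi x y| <= C.
  have [C PC] := lipschitz_compact_bounded (compact_setX cX cY) hlip.
  by exists C => x y Xx Yy; exact: (PC (x, y)).
have X1P x : X x -> X1 (lsubmx x) by move=> Xx; rewrite -hprojX.1; exists x.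
have Y1P y : Y y -> Y1 (lsubmx y) by move=> Yy; rewrite -hprojY.1; exists y.
have X1x i : X1 (x1 i).
  by have [[]] := protI i; rewrite /wI row_mxKl.
have Y1y i : Y1 (y1 i).
  by have [[]] := protI i; rewrite /wI row_mxKr.
(* The tuple [((x2, G), (y2, H))] is chosen at once, because all four objects belong to the same
   frontier point. Here [H] is still a supergradient of [Phi]; its sign is changed when it enters
   the protocol. *)
have /choice [c cP] : forall i, exists c : ('rV[R]_n2 * 'rV[R]_(n1 + n2)) *
    ('rV[R]_m2 * 'rV[R]_(m1 + m2)),
  let x := row_mx (x1 i) c.1.1 in let y := row_mx (y1 i) c.2.1 in
  [/\ X x, Y y, subdiff X (Phi^~ y) x c.1.2 /\ superdiff Y (Phi x) y c.2.2
    , sub_compatible X x c.1.2 (phix (x1 i) (y1 i))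
    & super_compatible Y y c.2.2 (phiy (x1 i) (y1 i))].
  move=> i; have [x2 [y2 /= [[Xx Yy _] [G [[dG _] cG]] [H [[dH _] cH]]]]] :=
    hreg _ _ (X1x i) (Y1y i).
  by exists ((x2, G), (y2, H)).
exists (fun i => (c i).1.1), (fun i => (c i).1.2).
exists (fun i => (c i).2.1), (fun i => - (c i).2.2) => x y z F.
have Xx i : X (x i) by have [] := cP i.
have Yy i : Y (y i) by have [] := cP i.
have dG i : subdiff X (Phi^~ (y i)) (x i) (c i).1.2 by have [_ _ []] := cP i.
have dH i : subdiff Y (fun y' => - Phi (x i) y') (y i) (- (c i).2.2).
  have [_ _ [_ dH] _ _ y' Yy'] := cP i.
  by rewrite dotNl -opprD lerN2; exact: dH.
have cG i x' : X x' -> dot (phix (x1 i) (y1 i)) (lsubmx x' - x1 i)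
    <= dot (c i).1.2 (x' - x i).
  have [_ _ _ cG _ Xx'] := cP i.
  by have := cG _ Xx'; rewrite row_mxKl.
have cH i y' : Y y' -> dot (- phiy (x1 i) (y1 i)) (lsubmx y' - y1 i)
    <= dot (- (c i).2.2) (y' - y i).
  have [_ _ _ _ cH Yy'] := cP i.
  by have := cH _ Yy'; rewrite row_mxKl !dotNl lerN2.
split=> //.
- by move=> i; split; [exact: Xx|exact: Yy].
- by move=> i; split; [exact: dG|exact: dH|exact: cG|exact: cH].
- move=> i; rewrite /z /F !row_mxKl !row_mxKr; split=> //.
  by rewrite /prodset /= row_mxKl row_mxKr.

(* Residual and gap bounds for a given certificate *)
move=> lambda lambdaP r zt xt yt.
have [l0 l1] := lambdaP.
have xtE : xt = \sum_i lambda 0 i *: x i.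
  by rewrite /xt /zt linear_sum; apply: eq_bigr => i _;
    rewrite linearZ /= row_mxKl.
have ytE : yt = \sum_i lambda 0 i *: y i.
  by rewrite /yt /zt linear_sum; apply: eq_bigr => i _;
    rewrite linearZ /= row_mxKr.
(* [jensen] gives membership of the average along with the inequality, so some convex function on
   [X] must be supplied; a point [y0] of [Y], lifted from [Y1], provides one. *)
have Xxt : X xt.
  have [y0 Yy0] : Y !=set0.
    by have [[b]] := hY1; rewrite -hprojY.1 => -[y0 Yy0 _]; exists y0.
  by rewrite xtE; have [] := jensen cvX (hconvex _ Yy0) lambdaP Xx.
have Yyt : Y yt by rewrite ytE; have [] := jensen cvY (hconcave _ Xxt) lambdaP Yy.
have ResJI : (Res z F lambda (prodset X Y) <= r)%E.
  apply: ge_ereal_sup => _ [w [Xw Yw] <-].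
  apply: (@le_trans _ _ (\sum_i lambda 0 i *
      dot (MI i) (wI i - row_mx (lsubmx (lsubmx w)) (lsubmx (rsubmx w))))%:E).
    rewrite lee_fin; apply: ler_sum => i _; rewrite ler_wpM2l//.
    rewrite !dot_row_mxB row_mxKl row_mxKr lerN2 lerD//; [exact: cG|exact: cH].
  apply: ereal_sup_ubound.
  exists (row_mx (lsubmx (lsubmx w)) (lsubmx (rsubmx w))) => //.
  by rewrite /prodset /= row_mxKl row_mxKr; split; [exact: X1P|exact: Y1P].
have gap x' y' : X x' -> Y y' -> ((Phi xt y' - Phi x' yt)%:E <= r)%E.
  move=> Xx' Yy'; apply: le_trans ResJI.
  apply: (@le_trans _ _ (\sum_i lambda 0 i *
      dot (F i) (z i - row_mx x' y'))%:E); last first.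
    apply: ereal_sup_ubound; exists (row_mx x' y') => //.
    by rewrite /prodset /= row_mxKl row_mxKr.
  rewrite lee_fin.
  (* Adding the inequalities for [G i] at [x'] and [H i] at [y'] cancels [Phi (x i) (y i)]. What
     remains is averaged by Jensen, in [x] at fixed [y'] and in [y] at fixed [x']. *)
  apply: (@le_trans _ _ (\sum_i lambda 0 i *
      (Phi (x i) y' - Phi x' (y i)))); last first.
    apply: ler_sum => i _; rewrite ler_wpM2l// dot_row_mxB row_mxKl row_mxKr.
    have := dG i _ Xx'; have := dH i _ Yy'; lra.
  have [_] := jensen cvX (hconvex _ Yy') lambdaP Xx.
  have [_] := jensen cvY (hconcave _ Xx') lambdaP Yy.
  rewrite -xtE -ytE.
  under [X in _ <= X -> _]eq_bigr do rewrite mulrN.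
  under [X in _ -> _ -> _ <= X]eq_bigr do rewrite mulrBr.
  by rewrite sumrN sumrB lerN2 => ? ?; exact: lerB.
(* The gap at [(xt, yt)] is a real number below [r], which excludes minus infinity; for plus
   infinity all the bounds are trivial. *)
have [r_pinfty|[rr rE]] : r = +oo%E \/ exists rr, r = rr%:E.
  have := gap _ _ Xxt Yyt; case: r {ResJI gap} => [rr||] // _; last by left.
  by right; exists rr.
  by split; rewrite // r_pinfty leey.
have {}gap x' y' : X x' -> Y y' -> Phi xt y' <= rr + Phi x' yt.
  by move=> Xx' Yy'; rewrite -lerBlDr -lee_fin -rE; exact: gap.

(* Transfer of the real gap bound to [Phi], [phi] and [psi] *)
rewrite rE.
have row_xt : row_mx (lsubmx xt) (rsubmx xt) = xt by rewrite hsubmxK.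
have row_yt : row_mx (lsubmx yt) (rsubmx yt) = yt by rewrite hsubmxK.
(* Surjectivity of the projections makes all sections nonempty, as the inf-sup bounds require. *)
have section2X_neq0 x1' : X1 x1' -> section2 X x1' !=set0.
  by rewrite -hprojX.1 => -[x' Xx' <-];
  exists (rsubmx x'); rewrite /section2 /= hsubmxK.
have section2Y_neq0 y1' : Y1 y1' -> section2 Y y1' !=set0.
  by rewrite -hprojY.1 => -[y' Yy' <-];
  exists (rsubmx y'); rewrite /section2 /= hsubmxK.
have section1X_neq0 x2' : X2 x2' -> section1 X x2' !=set0.
  by rewrite -hprojX.2 => -[x' Xx' <-];
  exists (lsubmx x'); rewrite /section1 /= hsubmxK.
have section1Y_neq0 y2' : Y2 y2' -> section1 Y y2' !=set0.
  by rewrite -hprojY.2 => -[y' Yy' <-];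
  exists (lsubmx y'); rewrite /section1 /= hsubmxK.
split; first by rewrite -rE.
- apply: eps_sad_le_fin; [by exists xt|by exists yt|] => x' y' Xx' Yy'.
  by rewrite row_mxKl row_mxKr; exact: gap.
- apply: eps_sad_le_fin; [by case: hX1|by case: hY1|] => u v X1u Y1v.
  rewrite row_mxKl row_mxKr -lerBlDl.
  (* With the averages as test points, the free variables [a] and [b] complete [u] and [v] to points
     [[u; a]] of [X] and [[v; b]] of [Y], where [gap] applies. *)
  apply: (@infsup_ge _ _ _ _ _ _ C _ (rsubmx yt)) => [? ? ? ?| | |].
  + exact: PhiC.
  + exact: section2X_neq0.
  + by rewrite /section2 /= row_yt.
  + move=> a Xa; rewrite row_yt lerBlDl.
    apply: (@infsup_le _ _ _ _ _ _ C _ (rsubmx xt)) => [? ? ? ?| | |].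
    * exact: PhiC.
    * exact: section2Y_neq0.
    * by rewrite /section2 /= row_xt.
    * by move=> b Yb; rewrite row_xt; exact: gap.
- apply: eps_sad_le_fin; [by case: hX2|by case: hY2|] => u v X2u Y2v.
  rewrite row_mxKl row_mxKr -lerBlDl.
  (* For [psi] the first components of the averages are the test points, and the completed points
     are [[a; u]] and [[b; v]]. *)
  apply: (@infsup_ge _ _ _ _ _ _ C _ (lsubmx yt)) => [? ? ? ?| | |].
  + exact: PhiC.
  + exact: section1X_neq0.
  + by rewrite /section1 /= row_yt.
  + move=> a Xa; rewrite row_yt lerBlDl.
    apply: (@infsup_le _ _ _ _ _ _ C _ (lsubmx xt)) => [? ? ? ?| | |].
    * exact: PhiC.
    * exact: section1Y_neq0.
    * by rewrite /section1 /= row_xt.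
    * by move=> b Yb; rewrite row_xt; exact: gap.
Qed.
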